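(* Let $G$ and $g$ be semi-infinite real matrices such that both $G$ and $\breve G:=G+g$ are $LU$-factorizable, $G=S_1^{-1}H(S_2^{-1})^\top$ and $\breve G=\breve S_1^{-1}\breve H(\breve S_2^{-1})^\top$, with associated monic polynomial sequences $P_\alpha=S_\alpha\chi$, $\breve P_\alpha=\breve S_\alpha\chi$ ($\alpha=1,2$) and $\breve H=\mathrm{diag}(\breve h_0,\breve h_1,\dots)$. Put $A:=S_1\,g\,S_2^\top$. Then for every $k\ge0$ $$\breve P_{1,k}(x)=\Theta_*\left[\begin{array}{c|c}(H+A)^{[k]}&\begin{matrix}P_{1,0}(x)\\ \vdots\\ P_{1,k-1}(x)\end{matrix}\\ \hline \begin{matrix}A_{k,0}&\cdots&A_{k,k-1}\end{matrix}&P_{1,k}(x)\end{array}\right],\qquad \breve P_{2,k}(x)=\Theta_*\left[\begin{array}{c|c}(H+A)^{[k]}&\begin{matrix}A_{0,k}\\ \vdots\\ A_{k-1,k}\end{matrix}\\ \hline \begin{matrix}P_{2,0}(x)&\cdots&P_{2,k-1}(x)\end{matrix}&P_{2,k}(x)\end{array}\right],$$ $$\breve h_k=\Theta_*\left[\begin{array}{c|c}(H+A)^{[k]}&\begin{matrix}A_{0,k}\\ \vdots\\ A_{k-1,k}\end{matrix}\\ \hline \begin{matrix}A_{k,0}&\cdots&A_{k,k-1}\end{matrix}&(H+A)_{k,k}\end{array}\right].$$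
   Context: Semi-infinite matrices and vectors are indexed from $0$; $A^{[k]}$ denotes the leading $k\times k$ truncation. A semi-infinite matrix $G$ (a Sobolev moment matrix) is $LU$-factorizable if $\det G^{[k]}\neq0$ for all $k\ge1$; then there are unique lower unitriangular $S_1,S_2$ and diagonal $H$ with $G=S_1^{-1}H(S_2^{-1})^\top$. $\chi(x)=(1,x,x^2,\dots)^\top$. The last quasi-determinant (Schur complement) is $\Theta_*\left[\begin{array}{c|c}A&B\\ \hline C&D\end{array}\right]:=D-CA^{-1}B$ (equal to $D$ when the block $A$ is empty). *)

(* Defs.v *)
From HB Require Import structures.
From mathcomp Require Import all_boot all_order all_algebra.
From mathcomp Require Import boolp classical_sets functions fsbigop reals.

Set Implicit Arguments.
Unset Strict Implicit.
Unset Printing Implicit Defensive.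

Import Order.TTheory GRing.Theory Num.Theory.

Local Open Scope classical_set_scope.
Local Open Scope ring_scope.

(* Semi-infinite matrices, rows and columns indexed from 0. Their sum is the
   pointwise sum of functions. *)
Notation simx R := (nat -> nat -> R).

(* The entry is the sum over all of nat when only finitely many terms are
   nonzero, and 0 otherwise; the sum is finite for every entry when A is lower
   triangular or B is upper triangular. *)
Definition simul (R : realType) (A B : simx R) : simx R :=
  fun i j => \sum_(l \in [set: nat]) A i l * B l j.

Definition sitr (R : realType) (A : simx R) : simx R := fun i j => A j i.

Definition sidiag (R : realType) (h : nat -> R) : simx R :=
  fun i j => if i == j then h i else 0.

Definition sione (R : realType) : simx R := sidiag (fun=> 1).

Definition sitrunc (R : realType) (A : simx R) (k : nat) : 'M[R]_k :=
  \matrix_(i < k, j < k) A i j.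

Definition lower_unitriangular (R : realType) (S : simx R) : Prop :=
  (forall i, S i i = 1) /\ (forall i j, (i < j)%N -> S i j = 0).

(* T = S^-1; both T and S are required to be lower unitriangular, so that the
   two products only involve finite sums. *)
Definition unitriangular_inverse (R : realType) (S T : simx R) : Prop :=
  [/\ lower_unitriangular S, lower_unitriangular T,
      simul S T = sione R & simul T S = sione R].

Definition LU_factorizable (R : realType) (G : simx R) : Prop :=
  forall k, (1 <= k)%N -> \det (sitrunc G k) != 0.

(* G = S1^-1 H (S2^-1)^T with S1, S2 lower unitriangular and
   H = diag(h 0, h 1, h 2, and so on). *)
Definition LU_factorization (R : realType) (G S1 : simx R) (h : nat -> R)
    (S2 : simx R) : Prop :=
  exists T1 T2 : simx R,
    [/\ unitriangular_inverse S1 T1, unitriangular_inverse S2 T2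
      & G = simul (simul T1 (sidiag h)) (sitr T2)].

Definition chi (R : realType) : nat -> {poly R} := fun j => 'X^j.

(* The k-th entry of S chi; only j <= k contributes when S is lower
   triangular. *)
Definition poly_seq (R : realType) (S : simx R) (k : nat) : {poly R} :=
  \sum_(j \in [set: nat]) S k j *: chi R j.

(* Last quasi-determinant of the block matrix (A B; C D) with scalar D.
   For k = 0 the product is an empty sum, hence the value is D. The inverse is
   meaningful only if A \in unitmx. *)
Definition last_quasidet (R : realType) (k : nat)
    (A : 'M[R]_k) (B : 'cV[R]_k) (C : 'rV[R]_k) (D : R) : R :=
  D - (C *m invmx A *m B) 0 0.

(* Main.v *)
Require Import Defs.
From HB Require Import structures.
From mathcomp Require Import all_boot all_order all_algebra.
From mathcomp Require Import boolp classical_sets functions fsbigop reals.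

(** Products in which the left factor is lower triangular, or the right factor
upper triangular, commute with truncation ([sitrunc_simul_lower],
[sitrunc_simul_upper]), so all the matrix algebra may be done on finite
matrices.

Since S1 G S2^T = H, the matrix K = H + A equals S1 (G + g) S2^T
([trunc_dressed]). Hence its leading truncations are invertible, and the
connection matrix N = bS1 S1^-1, lower unitriangular with bP1 = N P1, satisfies
  N K = bS1 (G + g) S2^T = bH (S2 bS2^-1)^T
([connection_elimination]), which is upper triangular with diagonal bh. So
row [k] of [N] is the row (c, 1) with which Gaussian elimination clears the
first [k] entries of row [k] of [K], which forces
c = - (K_k0, ..., K_k,k-1) (K^[k])^-1. Any Schur complement having this last row
is therefore the pairing of (c, 1) with its last column ([last_quasidet_row]).
With the column of values P1_i(x) the pairing gives (N P1)_k = bP1_k; with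
column [k] of [K] it gives the (k,k) entry of N K, that is bh_k. This is
[christoffel_left]. The formula for bP2 is the one for bP1 after exchanging
the two sides by transposition. *)

Set Implicit Arguments.
Unset Strict Implicit.
Unset Printing Implicit Defensive.

Import Order.TTheory GRing.Theory Num.Theory.

Local Open Scope ring_scope.

(** * Truncation of semi-infinite products *)

Lemma fsum_nat_trunc (V : nmodType) (F : nat -> V) n :
  (forall l, (n <= l)%N -> F l = 0) ->
  (\sum_(l \in [set: nat]) F l)%classic = \sum_(l < n) F l.
Proof.
move=> F0; rewrite fsbig_ord; apply/esym/fsbig_widen => //.
by move=> l [_ /= /negP]; rewrite -leqNgt => /F0.
Qed.

Section Truncation.
Variable R : realType.
Implicit Types (A B S T : simx R) (i j k n : nat).

Lemma simul_lowerE A B i j n :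
  (forall l, (i < l)%N -> A i l = 0) -> (i < n)%N ->
  simul A B i j = \sum_(l < n) A i l * B l j.
Proof.
move=> A0 lt_in; apply: fsum_nat_trunc => l le_nl.
by rewrite A0 ?mul0r // (leq_trans lt_in).
Qed.

Lemma simul_upperE A B i j n :
  (forall l, (j < l)%N -> B l j = 0) -> (j < n)%N ->
  simul A B i j = \sum_(l < n) A i l * B l j.
Proof.
move=> B0 lt_jn; apply: fsum_nat_trunc => l le_nl.
by rewrite B0 ?mulr0 // (leq_trans lt_jn).
Qed.

Lemma sitrunc_simul_lower A B n :
  (forall i j, (i < j)%N -> A i j = 0) ->
  sitrunc (simul A B) n = sitrunc A n *m sitrunc B n.
Proof.
move=> A0; apply/matrixP => i j; rewrite !mxE.
rewrite (@simul_lowerE _ _ _ _ n) //; last by move=> l; apply: A0.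
by apply: eq_bigr => l _; rewrite !mxE.
Qed.

Lemma sitrunc_simul_upper A B n :
  (forall i j, (j < i)%N -> B i j = 0) ->
  sitrunc (simul A B) n = sitrunc A n *m sitrunc B n.
Proof.
move=> B0; apply/matrixP => i j; rewrite !mxE.
rewrite (@simul_upperE _ _ _ _ n) //; last by move=> l; apply: B0.
by apply: eq_bigr => l _; rewrite !mxE.
Qed.

Lemma sitrunc_tr A n : sitrunc (sitr A) n = (sitrunc A n)^T.
Proof. by apply/matrixP => i j; rewrite !mxE. Qed.

Lemma sitruncD A B n : sitrunc (A + B) n = sitrunc A n + sitrunc B n.
Proof. by apply/matrixP => i j; rewrite !mxE. Qed.

Lemma sitrunc_one n : sitrunc (sione R) n = 1%:M.
Proof.
by apply/matrixP => i j; rewrite !mxE /sione /sidiag -val_eqE; case: eqP.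
Qed.

Lemma sitrunc_diag_tr (h : nat -> R) n :
  (sitrunc (sidiag h) n)^T = sitrunc (sidiag h) n.
Proof.
by apply/matrixP => i j; rewrite !mxE /sidiag eq_sym; case: eqP => // ->.
Qed.

Lemma lower_unitriangular_simul A B :
  lower_unitriangular A -> lower_unitriangular B ->
  lower_unitriangular (simul A B).
Proof.
move=> [A1 A0] [B1 B0]; split=> [i|i j lt_ij].
  rewrite (@simul_lowerE _ _ _ _ i.+1) //; last by move=> l; apply: A0.
  rewrite big_ord_recr /= A1 B1 mulr1 big1 ?add0r // => l _.
  by rewrite (B0 l) ?mulr0.
rewrite (@simul_lowerE _ _ _ _ i.+1) //; last by move=> l; apply: A0.
by rewrite big1 // => l _; rewrite (B0 l) ?mulr0 // (leq_trans (ltn_ord l)).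
Qed.

Lemma unitriangular_inverse_trunc S T n : unitriangular_inverse S T ->
  sitrunc S n *m sitrunc T n = 1%:M /\ sitrunc T n *m sitrunc S n = 1%:M.
Proof.
case=> [[_ S0] [_ T0] ST TS].
by rewrite -!sitrunc_simul_lower // ST TS sitrunc_one.
Qed.

Lemma LU_factorization_trunc (G S1 T1 S2 T2 : simx R) (h : nat -> R) n :
  unitriangular_inverse S1 T1 -> unitriangular_inverse S2 T2 ->
  G = simul (simul T1 (sidiag h)) (sitr T2) ->
  sitrunc S1 n *m sitrunc G n *m (sitrunc S2 n)^T = sitrunc (sidiag h) n.
Proof.
move=> U1 U2 ->.
have [S1T1 _] := unitriangular_inverse_trunc n U1.
have [S2T2 _] := unitriangular_inverse_trunc n U2.
have [[_ [_ T10] _ _] [_ [_ T20] _ _]] := (U1, U2).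
rewrite sitrunc_simul_upper; last by move=> i j; apply: T20.
rewrite sitrunc_simul_lower // sitrunc_tr !mulmxA S1T1 mul1mx -mulmxA.
by rewrite -trmx_mul S2T2 trmx1 mulmx1.
Qed.

Lemma horner_poly_seq S i n x : (forall i j, (i < j)%N -> S i j = 0) ->
  (i < n)%N -> (poly_seq S i).[x] = \sum_(j < n) S i j * x ^+ j.
Proof.
move=> S0 lt_in; rewrite /poly_seq (@fsum_nat_trunc _ _ n); last first.
  by move=> l le_nl; rewrite S0 ?scale0r // (leq_trans lt_in).
by rewrite horner_sum; apply: eq_bigr => j _; rewrite hornerZ hornerXn.
Qed.

(** bS = N S gives bP = N P; row [k] of this only involves monomials of degree at
most [k], so the truncated identity suffices. *)
Lemma poly_seq_connection (N S bS : simx R) k x :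
  (forall i j, (i < j)%N -> S i j = 0) ->
  (forall i j, (i < j)%N -> bS i j = 0) ->
  sitrunc bS k.+1 = sitrunc N k.+1 *m sitrunc S k.+1 ->
  (poly_seq bS k).[x] = \sum_(l < k.+1) N k l * (poly_seq S l).[x].
Proof.
move=> S0 bS0 bSE; rewrite (@horner_poly_seq _ _ k.+1) //.
under [RHS]eq_bigr => l _ do
  rewrite (@horner_poly_seq _ _ k.+1) // mulr_sumr.
rewrite exchange_big /=; apply: eq_bigr => j _.
have /matrixP/(_ ord_max j) := bSE; rewrite !mxE /= => ->.
by rewrite mulr_suml; apply: eq_bigr => l _; rewrite !mxE mulrA.
Qed.

(** * Schur complements and elimination *)

(** A row (c, 1) that annihilates the first [k] columns of [K] must have
c = - C (K^[k])^-1, so it computes every Schur complement with last row C,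
whatever the last column is. *)
Lemma last_quasidet_row (K N : simx R) k (u : 'I_k -> R) d :
  sitrunc K k \in unitmx ->
  (forall j, (j < k)%N -> \sum_(l < k) N k l * K l j + K k j = 0) ->
  last_quasidet (sitrunc K k) (\col_i u i) (\row_(j < k) K k j) d =
    \sum_(l < k) N k l * u l + d.
Proof.
move=> Ku NK0.
have cK : - (\row_(l < k) N k l) *m sitrunc K k = \row_(j < k) K k j.
  apply/rowP => j; rewrite mulNmx !mxE; apply/esym/eqP.
  rewrite -addr_eq0 addrC; apply/eqP; rewrite -[RHS](NK0 j) //.
  by congr (_ + _); apply: eq_bigr => l _; rewrite !mxE.
rewrite /last_quasidet -cK mulmxK // mulNmx !mxE opprK addrC.
by congr (_ + _); apply: eq_bigr => l _; rewrite !mxE.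
Qed.

Lemma last_quasidet_tr k (M : 'M[R]_k) (B : 'cV_k) (C : 'rV_k) d :
  last_quasidet M^T C^T B^T d = last_quasidet M B C d.
Proof.
rewrite /last_quasidet -trmx_inv -mulmxA -!trmx_mul.
by rewrite [in LHS]mxE.
Qed.

(** * The perturbed moment matrix *)

Lemma trunc_dressed (G g S1 S2 : simx R) (h : nat -> R) n :
  LU_factorization G S1 h S2 ->
  sitrunc (sidiag h + simul (simul S1 g) (sitr S2)) n =
    sitrunc S1 n *m sitrunc (G + g) n *m (sitrunc S2 n)^T.
Proof.
case=> T1 [T2 [U1 U2 GE]].
have [[_ S10] _ _ _] := U1; have [[_ S20] _ _ _] := U2.
rewrite !sitruncD -(LU_factorization_trunc n U1 U2 GE).
rewrite sitrunc_simul_upper; last by move=> i j; apply: S20.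
by rewrite sitrunc_simul_lower // sitrunc_tr mulmxDr mulmxDl.
Qed.

(** Inserting S1^-1 S1 and bT2^T bS2^T turns N K into
(bS1 M bS2^T) (S2 bT2)^T, whose first factor is D. *)
Lemma connection_elimination n (M D S1 T1 S2 bS1 bS2 bT2 : 'M[R]_n) :
  T1 *m S1 = 1%:M -> bT2 *m bS2 = 1%:M -> bS1 *m M *m bS2^T = D ->
  (bS1 *m T1) *m (S1 *m M *m S2^T) = D *m (S2 *m bT2)^T.
Proof.
move=> TS TS2 <-; rewrite trmx_mul !mulmxA -(mulmxA bS1 T1) TS mulmx1.
by rewrite -(mulmxA (_ *m M) bS2^T) -trmx_mul TS2 trmx1 mulmx1.
Qed.

(** With M the moment matrix and N = bS1 S1^-1, both Schur complements are read
off row [k] of N K = D (S2 bS2^-1)^T, which is upper triangular with the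
diagonal of D. *)
Lemma christoffel_left (K M S1 T1 S2 T2 bS1 bT1 bS2 bT2 : simx R)
    (d : nat -> R) k :
  unitriangular_inverse S1 T1 -> unitriangular_inverse S2 T2 ->
  unitriangular_inverse bS1 bT1 -> unitriangular_inverse bS2 bT2 ->
  sitrunc K k \in unitmx ->
  (forall n, sitrunc K n = sitrunc S1 n *m sitrunc M n *m (sitrunc S2 n)^T) ->
  (forall n, sitrunc bS1 n *m sitrunc M n *m (sitrunc bS2 n)^T =
     sitrunc (sidiag d) n) ->
  (forall x, (poly_seq bS1 k).[x] =
     last_quasidet (sitrunc K k) (\col_(i < k) (poly_seq S1 i).[x])
                   (\row_(j < k) K k j) (poly_seq S1 k).[x]) /\
  d k = last_quasidet (sitrunc K k) (\col_(i < k) K i k)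
                      (\row_(j < k) K k j) (K k k).
Proof.
move=> U1 U2 bU1 bU2 Ku KE DE.
have [_ TS1] := unitriangular_inverse_trunc k.+1 U1.
have [_ bTS2] := unitriangular_inverse_trunc k.+1 bU2.
have [[LS1 LT1 _ _] [LS2 _ _ _]] := (U1, U2).
have [[LbS1 _ _ _] [_ LbT2 _ _]] := (bU1, bU2).
have [[[_ S10] [_ S20]] [_ bS10]] := (LS1, LS2, LbS1).
pose N := simul bS1 T1; pose V := simul S2 bT2.
have [N1 _] : lower_unitriangular N by apply: lower_unitriangular_simul.
have [V1 V0] : lower_unitriangular V by apply: lower_unitriangular_simul.
have bSE : sitrunc bS1 k.+1 = sitrunc N k.+1 *m sitrunc S1 k.+1.
  by rewrite sitrunc_simul_lower // -mulmxA TS1 mulmx1.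
have NKE : sitrunc N k.+1 *m sitrunc K k.+1 =
    sitrunc (sidiag d) k.+1 *m (sitrunc V k.+1)^T.
  rewrite !sitrunc_simul_lower // KE.
  exact: connection_elimination TS1 bTS2 (DE _).
clearbody N V.
have NKrow j : (j < k.+1)%N ->
    \sum_(l < k) N k l * K l j + K k j = d k * V j k.
  move=> lt_jk; have /matrixP/(_ ord_max (Ordinal lt_jk)) := NKE.
  rewrite !mxE !big_ord_recr /= !mxE /= N1 mul1r /sidiag eqxx.
  rewrite [X in _ = X + _]big1 ?add0r => [<-|l _].
    by congr (_ + _); apply: eq_bigr => l _; rewrite !mxE.
  by rewrite !mxE /= eq_sym (ltn_eqF (ltn_ord l)) mul0r.
have NK0 j : (j < k)%N -> \sum_(l < k) N k l * K l j + K k j = 0.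
  by move=> lt_jk; rewrite NKrow ?V0 ?mulr0 // ltnW.
split=> [x|]; rewrite (@last_quasidet_row _ N) //.
  by rewrite (poly_seq_connection x S10 bS10 bSE) big_ord_recr /= N1 mul1r.
by rewrite NKrow // V1 mulr1.
Qed.

End Truncation.

Theorem proposition7 (R : realType) (G g : simx R)
    (S1 S2 bS1 bS2 : simx R) (h bh : nat -> R)
    (G_fact : LU_factorizable G)
    (bG_fact : LU_factorizable (G + g))
    (G_LU : LU_factorization G S1 h S2)
    (bG_LU : LU_factorization (G + g) bS1 bh bS2) :
  let A : simx R := simul (simul S1 g) (sitr S2) in
  let HA : simx R := sidiag h + A in
  let P1 := poly_seq S1 in
  let P2 := poly_seq S2 in
  let bP1 := poly_seq bS1 in
  let bP2 := poly_seq bS2 in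
  forall k : nat,
    [/\ sitrunc HA k \in unitmx,
        forall x : R,
          (bP1 k).[x] =
          last_quasidet (sitrunc HA k) (\col_(i < k) (P1 i).[x])
                        (\row_(j < k) A k j)   (P1 k).[x],
        forall x : R,
          (bP2 k).[x] =
          last_quasidet (sitrunc HA k)         (\col_(i < k) A i k)
                        (\row_(j < k) (P2 j).[x]) (P2 k).[x]
      & bh k =
          last_quasidet (sitrunc HA k)         (\col_(i < k) A i k)
                        (\row_(j < k) A k j)   (HA k k)].
Proof.
move=> A HA P1 P2 bP1 bP2 k.
have KE n :
    sitrunc HA n = sitrunc S1 n *m sitrunc (G + g) n *m (sitrunc S2 n)^T.
  exact: trunc_dressed.
have [T1 [T2 [U1 U2 _]]] := G_LU.
have [bT1 [bT2 [bU1 bU2 bGE]]] := bG_LU.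
have bD n := LU_factorization_trunc n bU1 bU2 bGE.
have Ku : sitrunc HA k \in unitmx.
  have [/mulmx1_unit[S1u _] _] := unitriangular_inverse_trunc k U1.
  have [/mulmx1_unit[S2u _] _] := unitriangular_inverse_trunc k U2.
  rewrite KE !unitmx_mul unitmx_tr S1u S2u andbT unitmxE unitfE.
  (* factorizability says nothing about the empty truncation *)
  by case: (k) => [|m]; [rewrite det_mx00 oner_eq0 | apply: bG_fact].
(* H is diagonal, so A and K = H + A agree off the diagonal *)
have rowE : \row_(j < k) A k j = \row_(j < k) HA k j.
  apply/rowP => j; rewrite !mxE /HA !fctE /sidiag.
  by rewrite eq_sym (ltn_eqF (ltn_ord j)) add0r.
have colE : \col_(i < k) A i k = \col_(i < k) HA i k.
  apply/colP => i; rewrite !mxE /HA !fctE /sidiag.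
  by rewrite (ltn_eqF (ltn_ord i)) add0r.
have [bP1E bhE] := christoffel_left U1 U2 bU1 bU2 Ku KE bD.
(* the second family is the first one of the transposed moment matrix *)
have Kut : sitrunc (sitr HA) k \in unitmx by rewrite sitrunc_tr unitmx_tr.
have KEt n : sitrunc (sitr HA) n =
    sitrunc S2 n *m sitrunc (sitr (G + g)) n *m (sitrunc S1 n)^T.
  by rewrite (sitrunc_tr HA) (sitrunc_tr (G + g)) KE !trmx_mul trmxK mulmxA.
have bDt n : sitrunc bS2 n *m sitrunc (sitr (G + g)) n *m (sitrunc bS1 n)^T =
    sitrunc (sidiag bh) n.
  rewrite -[RHS]sitrunc_diag_tr -(bD n) (sitrunc_tr (G + g)).
  by rewrite !trmx_mul trmxK mulmxA.
have [bP2E _] := christoffel_left U2 U1 bU2 bU1 Kut KEt bDt.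
split=> //.
- by move=> x; rewrite rowE; apply: bP1E.
- move=> x; rewrite colE -last_quasidet_tr -sitrunc_tr.
  rewrite [LHS]bP2E; congr last_quasidet.
    by apply/colP => i; rewrite !mxE.
  by apply/rowP => i; rewrite !mxE.
- by rewrite rowE colE.
Qed.
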